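(* Every one-point convergence space is a quasialgebraic space. Consequently, every one-point convergence space is core compact.
   Context: One-point convergence spaces: for a (non-empty) directed poset $D$ and an element $\infty\notin D$, let $\beta_D$ be the topology on $D\cup\{\infty\}$ having as a subbase all sets $\uparrow x$ and $\uparrow x\cup\{\infty\}$, $x\in D$, where $\uparrow x=\{y\in D:x\le y\}$. The spaces $(D\cup\{\infty\},\beta_D)$ are the one-point convergence spaces. For a $T_0$ space $X$ with specialization order $x\sqsubseteq y$ iff $x\in\overline{\{y\}}$ and $F\subseteq X$, write $\uparrow F=\{x\in X:\exists a\in F,\ a\sqsubseteq x\}$. $X$ is quasialgebraic if for every open $U$ and $x\in U$ there is a finite $F\subseteq X$ with $x\in\mathrm{int}(\uparrow F)=\uparrow F\subseteq U$. $X$ is core compact if for every open $V$ and $x\in V$ there is an open $U$ with $x\in U\ll V$, where $U\ll V$ means that every open cover of $V$ has a finite subfamily covering $U$. *)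

(* Defs.v *)
From HB Require Import structures.
From mathcomp Require Import all_boot all_order.
From mathcomp Require Import all_classical topology.

Set Implicit Arguments.
Unset Strict Implicit.
Unset Printing Implicit Defensive.

Local Open Scope classical_set_scope.

Definition directed_poset (d : Order.disp_t) (D : porderType d) : Prop :=
  [set: D] !=set0 /\
  forall x y : D, exists z : D, (x <= z)%O /\ (y <= z)%O.

(* The set D together with the extra point infinity, which is [None].  It is an
   alias of [option D] so as to carry its own topology. *)
Definition one_point_convergence (d : Order.disp_t) (D : porderType d) : Type :=
  option D.

Section one_point_convergence.
Context (d : Order.disp_t) (D : porderType d).

Local Notation X := (one_point_convergence D).

HB.instance Definition _ := Choice.on X.

(* The cone taken in D and seen in X: it never contains infinity. *)
Definition cone (x : D) : set X := Some @` [set y : D | (x <= y)%O].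

Definition one_point_subbase : set_system X :=
  [set U | exists x : D, U = cone x \/ U = cone x `|` [set None]].

(* The generated topology: arbitrary unions of finite intersections of members
   of the subbase, the empty intersection being the whole space. *)
HB.instance Definition _ := isSubBaseTopological.Build X one_point_subbase id.

End one_point_convergence.

Section spaces.
Context (X : topologicalType).

Definition specialization_le (x y : X) : Prop := closure [set y] x.

Definition up_closure (F : set X) : set X :=
  [set x | exists2 a, F a & specialization_le a x].

(* The notion is only considered among T0 spaces, so T0 is part of it. *)
Definition quasialgebraic_space : Prop :=
  kolmogorov_space X /\
  forall (U : set X) (x : X), open U -> U x ->
    exists F : set X,
      [/\ finite_set F,
          (up_closure F)° x,
          (up_closure F)° = up_closure F
        & up_closure F `<=` U].

Definition way_below (U V : set X) : Prop :=
  forall (I : choiceType) (D : set I) (f : I -> set X),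
    (forall i, D i -> open (f i)) -> V `<=` cover D f ->
    finite_subset_cover D f U.

Definition core_compact_space : Prop :=
  forall (V : set X) (x : X), open V -> V x ->
    exists U : set X, [/\ open U, U x & way_below U V].

End spaces.

Arguments quasialgebraic_space : clear implicits.
Arguments core_compact_space : clear implicits.

(* Main.v *)
Require Import Defs.
From mathcomp Require Import all_boot all_order.
From mathcomp Require Import all_classical topology.
From mathcomp Require Import finmap.

Set Implicit Arguments.
Unset Strict Implicit.
Unset Printing Implicit Defensive.

Import Order.TTheory.

Local Open Scope classical_set_scope.

(** The space is quasialgebraic because each point has small open
    neighbourhoods that are upper closures of finite sets.  A point of [D] has
    a least neighbourhood, its cone, which is also its upper closure.  Infinity
    has no least neighbourhood in general, but directedness of [D] says that
    the sets [cone z `|` [set None]] form a filter base, hence a basis of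
    neighbourhoods of infinity ([openNone]); such a set is the upper closure of
    the two points [z] and infinity ([up_closure_None]), even when [D] has a
    greatest element, the only case in which infinity lies below a point of
    [D].

    Core compactness then holds in any quasialgebraic space: open sets are
    upper sets for the specialization order, so finitely many members of an
    open cover that catch a finite set [F] cover all of [up_closure F].  An
    open set of the form [up_closure F] is therefore way below every open set
    that contains it ([up_closure_way_below]). *)

Section specialization.
Context (X : topologicalType).
Implicit Types (F U V : set X) (x y : X).

Lemma open_specialization U x y :
  open U -> specialization_le x y -> U x -> U y.
Proof.
move=> oU xy Ux.
by have [_ [-> Uy]] := xy U (open_nbhs_nbhs (conj oU Ux)).
Qed.

Lemma sub_up_closure F : F `<=` up_closure F.
Proof. by move=> x Fx; exists x => //; exact: subset_closure. Qed.

(** The subfamily is chosen to cover the finite set [F] only; its members are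
    upper sets, so they cover the whole of [up_closure F]. *)
Lemma up_closure_way_below F V : finite_set F -> up_closure F `<=` V ->
  way_below (up_closure F) V.
Proof.
move=> finF FV I D f fo VD.
have FD a : F a -> exists i, D i /\ f i a.
  by move=> /sub_up_closure/FV/VD[i Di fia]; exists i.
have [E ED FE] : finite_subset_cover D f F.
  move: finF FD => {FV} /finite_fsetP[A ->] AD.
  have [[a0 /AD[i0 _]]|A0] := pselect ([set` A] !=set0); last first.
    by exists fset0 => // a Aa; exfalso; apply: A0; exists a.
  (* [i0] is the value of the choice function off the finite set. *)
  have /choice[g gP] : forall a, exists i, a \in A -> D i /\ f i a.
    move=> a; have [/AD[i Pi]|] := boolP (a \in A); first by exists i.
    by exists i0.
  exists (g @` A)%fset.
    by move=> _ /imfsetP[a /= aA ->]; apply/mem_set; case: (gP a aA).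
  move=> a aA; exists (g a); first exact: in_imfset.
  by case: (gP a aA).
exists E => // x [a /FE[i iE fia] ax]; exists i => //.
by apply: open_specialization ax fia; apply: fo; exact/set_mem/ED.
Qed.

Lemma quasialgebraic_core_compact :
  quasialgebraic_space X -> core_compact_space X.
Proof.
move=> [_ qX] V x oV Vx; have [F [finF Fx Fo FV]] := qX V x oV Vx.
exists (up_closure F); split; first exact/interior_id.
- by rewrite -Fo.
- exact: up_closure_way_below.
Qed.

End specialization.

Section one_point.
Context (d : Order.disp_t) (D : porderType d).
Local Notation X := (one_point_convergence D).
Implicit Types (x y z : D) (U : set X).

Local Notation coneN z := (cone z `|` [set (None : X)]).

Lemma coneE x y : cone x (Some y) = (x <= y)%O :> Prop.
Proof.
by apply/propext; split=> [[_ /[swap] -[->]]|xy] //; exists y.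
Qed.

Lemma coneNone x : ~ cone x None.
Proof. by case. Qed.

Lemma sub_cone x y : (x <= y)%O -> cone y `<=` cone x.
Proof. by move=> xy [z|/coneNone//]; rewrite !coneE; exact: le_trans. Qed.

Lemma open_subbase U : one_point_subbase U -> open U.
Proof.
move=> sU; exists [set U]; last by rewrite bigcup_set1.
by move=> _ ->; exact: finI_from1.
Qed.

Lemma open_cone x : open (cone x).
Proof. by apply: open_subbase; exists x; left. Qed.

Lemma open_coneN x : open (coneN x).
Proof. by apply: open_subbase; exists x; right. Qed.

(** Basic open sets are finite intersections, which is all that a filter has
    to absorb: neighbourhoods of a point need only be tested on the subbase. *)
Lemma open_in_filter (G : set_system X) (p : X) : Filter G ->
  (forall S, one_point_subbase S -> S p -> G S) ->
  forall U, open U -> U p -> G U.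
Proof.
move=> FG Gp U [B sB <-] [_ /[dup] /sB[E sE <-] BE Ep].
apply: (filterS (P := \bigcap_(i in [set` E]) i)).
  by move=> q Eq; eexists; [exact: BE|].
apply: filter_bigI => S SE; apply: Gp; last exact: Ep.
exact/set_mem/sE.
Qed.

Lemma openSome U x : open U -> U (Some x) -> cone x `<=` U.
Proof.
apply: (@open_in_filter (globally (cone x))) => S [y [|]] ->.
  by rewrite coneE => /sub_cone.
by move=> [|//]; rewrite coneE => /sub_cone yx q /yx; left.
Qed.

(** Directedness of [D] is what makes the sets [coneN z] a filter base, and the
    filter they generate contains every subbasic set through infinity. *)
Lemma openNone U : directed_poset D -> open U -> U None ->
  exists z, coneN z `<=` U.
Proof.
move=> [[x0 _] dirD] oU UN.
suff [z _ zU] : filter_from [set: D] (fun z => coneN z) U by exists z.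
apply: (@open_in_filter _ None) oU UN.
  apply: filter_from_filter; first by exists x0.
  move=> x y _ _; have [z [xz yz]] := dirD x y; exists z => //.
  by rewrite -setUIl; apply: setSU => q zq; split; apply: sub_cone zq.
by move=> S [y [|]] -> => [/coneNone//|_]; exists y.
Qed.

Lemma specialization_Some x : specialization_le (Some x : X) = cone x.
Proof.
apply/funext => q; apply/propext; split=> [xq|xq U].
  by apply: open_specialization (open_cone x) xq _; rewrite coneE.
rewrite nbhsE => -[V [oV Vx] VU]; exists q; split=> //.
by apply: VU; apply: openSome xq.
Qed.

Lemma up_closure_Some x : up_closure [set (Some x : X)] = cone x.
Proof.
apply/seteqP; split=> [q [_ ->]|q xq]; first by rewrite specialization_Some.
by exists (Some x) => //; rewrite specialization_Some.
Qed.

(** One inclusion is that [coneN z] is open, hence an upper set: if infinity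
    lies below a point of [D], that point is in every [coneN z]. *)
Lemma up_closure_None z :
  up_closure [set (Some z : X); (None : X)] = coneN z.
Proof.
apply/seteqP; split=> [q [a az aq]|q].
  apply: open_specialization (open_coneN z) aq _.
  by case: az => ->; [left; rewrite coneE|right].
case=> [zq|->]; last by apply: sub_up_closure; right.
by exists (Some z); [left|rewrite specialization_Some].
Qed.

Lemma one_point_kolmogorov : kolmogorov_space X.
Proof.
have sep x (q : X) : ~ cone x q ->
    cone x \in nbhs (Some x : X) /\ q \in ~` cone x.
  move=> xq; split; apply/mem_set => //.
  by apply: open_nbhs_nbhs; split; [exact: open_cone|rewrite coneE].
move=> [x|] [y|] // neq.
- have [xy|nxy] := boolP (x <= y)%O.
    exists (cone y); right; apply: sep; rewrite coneE => yx.
    by move/eqP: neq; apply; congr Some; apply/le_anti; rewrite xy.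
  by exists (cone x); left; apply: sep; rewrite coneE; exact/negP.
- by exists (cone x); left; apply/sep/coneNone.
- by exists (cone y); right; apply/sep/coneNone.
Qed.

Lemma one_point_quasialgebraic : directed_poset D -> quasialgebraic_space X.
Proof.
move=> hD; split=> [|U [x|] oU Up]; first exact: one_point_kolmogorov.
- exists [set (Some x : X)]; rewrite up_closure_Some.
  have /interior_id -> := open_cone x.
  by split=> //; [rewrite coneE|exact: openSome].
- have [z zU] := openNone hD oU Up.
  exists [set (Some z : X); (None : X)]; rewrite up_closure_None.
  have /interior_id -> := open_coneN z.
  by split=> //; right.
Qed.

End one_point.

Theorem proposition12 (d : Order.disp_t) (D : porderType d)
    (hD : directed_poset D) :
  quasialgebraic_space (one_point_convergence D) /\
  core_compact_space (one_point_convergence D).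
Proof.
have qX := one_point_quasialgebraic hD.
by split=> //; exact: quasialgebraic_core_compact.
Qed.
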